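(* There exist absolute constants $C_1, C_2, c > 0$ and $\epsilon\in(0,1/4)$ such that for every integer $d\ge 1$ there is $p_0=p_0(d)$ for which the following holds for all integers $p\ge p_0$. Put $\delta=\lceil C_1\log p\rceil$ and $m=\lceil C_2\sqrt{dp}\,\log p\rceil$. Let $X\in\mathbb{R}^{p\times p}$ be an arbitrary fixed matrix. Let $A,B$ be $m\times p$ matrices such that either (a) $A$ and $B$ are drawn independently from the $\delta$-random bipartite ensemble, or (b) $A$ is drawn from the $\delta$-random bipartite ensemble and $B=A$. Then with probability exceeding $1-p^{-c}$ (over the draw of $A,B$), any optimal solution $X^\ast$ of $$\text{minimize}_{\tilde X\in\mathbb{R}^{p\times p}}\ \|\tilde X\|_1\quad\text{subject to}\quad A\tilde X B^T=AXB^T$$ satisfies $$\|X^\ast-X\|_1\le\frac{2-4\epsilon}{1-4\epsilon}\,\min_{\Omega\in\mathfrak{W}_{d,p}}\|X-X_\Omega\|_1 .$$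
   Context: Notation: $[p]=\{1,\dots,p\}$; for a matrix $M$, $\|M\|_1=\sum_{i,j}|M_{ij}|$ (entrywise $\ell_1$ norm). $\mathfrak{W}_{d,p}$ is the collection of all subsets $\Omega\subset[p]\times[p]$ such that $|\Omega\cap(\{i\}\times[p])|\le d$ and $|\Omega\cap([p]\times\{i\})|\le d$ for all $i\in[p]$. For $\Omega\subset[p]\times[p]$ and $X\in\mathbb{R}^{p\times p}$, $X_\Omega$ is the matrix with $[X_\Omega]_{ij}=X_{ij}$ if $(i,j)\in\Omega$ and $0$ otherwise. $\delta$-random bipartite ensemble (of $m\times p$ matrices): for each left vertex $i\in[p]$, choose $\delta$ right vertices $j_1(i),\dots,j_\delta(i)\in[m]$ independently and uniformly at random with replacement, independently over different $i$; this gives a random $\delta$-left regular bipartite (multi)graph with left set $[p]$ and right set $[m]$. The matrix $A\in\mathbb{R}^{m\times p}$ has entries $A_{ji}=\#\{k\in[\delta]: j_k(i)=j\}$ (the number of edges joining left vertex $i$ to right vertex $j$). *)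

(* Defs.v *)
From mathcomp Require Import all_boot all_order all_algebra.
From mathcomp Require Import boolp reals exp.
Set Implicit Arguments.
Unset Strict Implicit.
Unset Printing Implicit Defensive.
Import Order.TTheory GRing.Theory Num.Theory.
Local Open Scope ring_scope.

Definition l1norm (R : realType) (m n : nat) (M : 'M[R]_(m, n)) : R :=
  \sum_(i < m) \sum_(j < n) `|M i j|.

(* Pairs are indexed from 0; at most d of them in each row and each column. *)
Definition distributed (d p : nat) : {set {set 'I_p * 'I_p}} :=
  [set Omega : {set 'I_p * 'I_p} | [forall i : 'I_p,
     (#|Omega :&: setX [set i] [set: 'I_p]| <= d)%N &&
     (#|Omega :&: setX [set: 'I_p] [set i]| <= d)%N]].

Definition mxrestrict (R : realType) (p : nat) (Omega : {set 'I_p * 'I_p})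
    (X : 'M[R]_p) : 'M[R]_p :=
  \matrix_(i, j) (if (i, j) \in Omega then X i j else 0).

Lemma set0_distributed (d p : nat) : set0 \in distributed d p.
Proof. by rewrite inE; apply/forallP => i; rewrite !set0I !cards0. Qed.

(* A minimum over a finite family, nonempty by [set0_distributed]: the empty
   set is only the witness of nonemptiness required by [arg min]. *)
Definition best_approx_err (R : realType) (d p : nat) (X : 'M[R]_p) : R :=
  let err Omega := l1norm (X - mxrestrict Omega X) in
  err [arg min_(Omega < set0 in distributed d p) err Omega]%O.

Lemma best_approx_errP (R : realType) (d p : nat) (X : 'M[R]_p) :
  (exists2 Omega, Omega \in distributed d p &
     best_approx_err d X = l1norm (X - mxrestrict Omega X)) /\
  (forall Omega, Omega \in distributed d p ->
     best_approx_err d X <= l1norm (X - mxrestrict Omega X)).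
Proof.
rewrite /best_approx_err; case: arg_minP; first exact: set0_distributed.
by move=> Omega OmegaW le_Omega; split=> //; exists Omega.
Qed.

(* Outcomes of the edge choices, [w i k] being the k-th right vertex chosen by
   the left vertex i. The uniform law on this finite type is the law of
   p * delta independent choices, each uniform on 'I_m (with replacement). *)
Definition edge_draw (m p delta : nat) : finType :=
  {ffun 'I_p -> {ffun 'I_delta -> 'I_m}}.

(* Entries count edges with multiplicity. *)
Definition ensemble_mx (R : realType) (m p delta : nat)
    (w : edge_draw m p delta) : 'M[R]_(m, p) :=
  \matrix_(j < m, i < p) (#|[set k : 'I_delta | w i k == j]|%:R).

Definition unifPr (R : realType) (T : finType) (E : T -> Prop) : R :=
  #|[pred w : T | `[< E w >]]|%:R / #|T|%:R.

Definition l1_optimal (R : realType) (m p : nat) (A B : 'M[R]_(m, p))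
    (X Xopt : 'M[R]_p) : Prop :=
  A *m Xopt *m B^T = A *m X *m B^T /\
  forall Y : 'M[R]_p, A *m Y *m B^T = A *m X *m B^T -> l1norm Xopt <= l1norm Y.

Definition l1_recovery (R : realType) (d : nat) (eps : R) (m p : nat)
    (X : 'M[R]_p) (A B : 'M[R]_(m, p)) : Prop :=
  forall Xopt : 'M[R]_p, l1_optimal A B X Xopt ->
    l1norm (Xopt - X) <= (2 - 4 * eps) / (1 - 4 * eps) * best_approx_err d X.

(* Only used on nonnegative reals, where it is the usual ceiling. *)
Definition nceil (R : realType) (x : R) : nat := `|Num.ceil x|%N.

(* Main.v *)
(* Let Omega be the best distributed support for X. For every pair (i, i'), at
   most a third of the delta^2 pairs of edges of (i, i') meet an edge pair of
   Omega minus (i, i'). Then for V in the kernel, the equations at the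
   right-hand pairs isolated in Omega give 2 |V_Omega| <= |V_(~ Omega)|, and the
   null space property yields the error constant 6 = (2 - 4/5) / (1 - 4/5).
   Since X, hence Omega, is fixed, no union bound over supports is needed. A
   collision with a pair sharing i or i' forces a single edge into a set of size
   O(d delta), negligible against m; the others force (j, j') into a set of
   density |Omega| delta^2 / m^2. These remain independent for B = A and i = i'
   once the edge pairs (k, k') are split into the matchings k + k' = r, and the
   union bound over the sets of bad indices gives a failure probability
   O(p^2) 4^delta 2^(- K delta), with p <= 2^delta. *)
Require Import Defs.
From mathcomp Require Import all_boot all_order all_algebra.
From mathcomp Require Import boolp reals exp.
From mathcomp Require Import zify ring lra.
Set Implicit Arguments.
Unset Strict Implicit.
Unset Printing Implicit Defensive.
Import Order.TTheory GRing.Theory Num.Theory.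
Local Open Scope nat_scope.

(** * Independence by counting, and the resulting tail bound *)

Lemma card_sum_pred (T : finType) (P : pred T) :
  #|[pred z | P z]| = \sum_z P z.
Proof. by rewrite -sum1_card big_mkcond. Qed.

(* A counting form of independence: [rho j z x] redraws, uniformly over x, the
   coordinates of z belonging to j, on which only the event [B j] depends among
   the [B j'], j' in A. *)
Lemma card_all_resample (Z X J : finType) (rho : J -> Z -> X -> Z)
    (B : J -> pred Z) (A : {set J}) (Q : nat) :
    0 < #|X| ->
    (forall j (g : Z -> nat),
       j \in A -> \sum_z \sum_x g (rho j z x) = #|X| * \sum_z g z) ->
    (forall j j' z x, j \in A -> j' \in A -> j' != j ->
       B j' (rho j z x) = B j' z) ->
    (forall j z, j \in A -> Q * #|[pred x | B j (rho j z x)]| <= #|X|) ->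
  forall D : {set J}, D \subset A ->
    Q ^ #|D| * #|[pred z | [forall j in D, B j z]]| <= #|Z|.
Proof.
move=> X0 rhoE Binv BQ D.
have [n] := ubnP #|D|; elim: n D => // n IHn D ltDn sDA.
have [->|[j jD]] := set_0Vmem D; first by rewrite cards0 mul1n max_card.
have jA := subsetP sDA j jD.
have sDjA : D :\ j \subset A by apply: subset_trans sDA; apply: subsetDl.
have ltDjn : #|D :\ j| < n by move: ltDn; rewrite (cardsD1 j) jD.
apply: leq_trans (IHn _ ltDjn sDjA).
rewrite (cardsD1 j D) jD expnS -mulnA mulnCA leq_mul2l; apply/orP; right.
(* Each count over z is replaced by its average over the redraws at j: the events of [D :\ j] do not
   notice the redraw, and [B j] holds for at most a fraction 1 / Q of the redrawn values. *)
rewrite !card_sum_pred -(leq_pmul2l X0) mulnCA -!(rhoE j) // big_distrr /=.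
apply: leq_sum => z _.
have eqD x : [forall j' in D, B j' (rho j z x)] =
    [forall j' in D :\ j, B j' z] && B j (rho j z x).
  apply/forall_inP/andP => [allB|[/forall_inP allB Bj] j' j'D].
    split; last exact: allB.
    by apply/forall_inP => j' /setD1P[j'j j'D]; rewrite -(Binv j j' z x) ?allB ?(subsetP sDA).
  have [-> //|j'j] := eqVneq j' j.
  by rewrite Binv ?(subsetP sDA) // allB // !inE j'j.
have eqDj x : [forall j' in D :\ j, B j' (rho j z x)] =
    [forall j' in D :\ j, B j' z].
  apply: eq_forallb => j'; case: (boolP (j' \in _)) => //= /setD1P[j'j j'D].
  by rewrite Binv ?(subsetP sDA).
under eq_bigr do rewrite eqD.
under [X in _ <= X]eq_bigr do rewrite eqDj.
rewrite sum_nat_const; case: [forall _ in _, _] => /=.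
  by rewrite muln1 -card_sum_pred BQ.
by rewrite big1 ?muln0.
Qed.

(** A union bound over the sets D of bad indices with n <= h * #|D|: there are at most 2 ^ #|J| of
    them, and all of D is bad on a fraction at most 2 ^ (- h K #|D|) <= 2 ^ (- K n) of the
    outcomes. *)
Lemma card_tail_resample (Z X J : finType) (rho : J -> Z -> X -> Z)
    (B : J -> pred Z) (A : {set J}) (h K n : nat) :
    0 < #|X| ->
    (forall j (g : Z -> nat),
       j \in A -> \sum_z \sum_x g (rho j z x) = #|X| * \sum_z g z) ->
    (forall j j' z x, j \in A -> j' \in A -> j' != j ->
       B j' (rho j z x) = B j' z) ->
    (forall j z, j \in A ->
       2 ^ (h * K) * #|[pred x | B j (rho j z x)]| <= #|X|) ->
  2 ^ (K * n) * #|[pred z | n <= h * #|[set j in A | B j z]|]| <=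
    2 ^ #|J| * #|Z|.
Proof.
move=> X0 rhoE Binv BQ.
pose F := [set D in powerset A | n <= h * #|D|].
have le1 : #|[pred z | n <= h * #|[set j in A | B j z]|]| <=
    \sum_(D in F) #|[pred z | [forall j in D, B j z]]|.
  under eq_bigr do rewrite card_sum_pred.
  rewrite exchange_big card_sum_pred; apply: leq_sum => z _.
  case: (leqP n) => // le_n; pose D := [set j in A | B j z].
  have DF : D \in F.
    by rewrite inE le_n powersetE andbT; apply/subsetP => j; rewrite inE => /andP[].
  rewrite (bigD1 D DF) /= (_ : [forall _ in _, _]) //.
  by apply/forall_inP => j; rewrite inE => /andP[].
apply: leq_trans (leq_mul (leqnn _) le1) _; rewrite big_distrr /=.
have leF D : D \in F ->
    2 ^ (K * n) * #|[pred z | [forall j in D, B j z]]| <= #|Z|.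
  rewrite inE powersetE => /andP[sDA leD].
  apply: leq_trans (card_all_resample X0 rhoE Binv BQ sDA).
  by rewrite leq_mul2r -expnM leq_exp2l // mulnAC [X in _ <= X]mulnC leq_mul2l leD !orbT.
apply: (@leq_trans (\sum_(D in F) #|Z|)); first exact: leq_sum.
rewrite sum_nat_const leq_mul2r.
have sFA : F \subset powerset A.
  by apply/subsetP => D; rewrite inE => /andP[].
apply/orP; right; apply: leq_trans (subset_leq_card sFA) _.
by rewrite card_powerset leq_exp2l // max_card.
Qed.

(** * Edge draws and the redrawing of single edges *)

Definition draw (I T : finType) (n : nat) : finType :=
  {ffun I -> {ffun 'I_n -> T}}.

Definition redraw (I T : finType) (n : nat) (i : I) (k : 'I_n)
    (z : draw I T n) (x : T) : draw I T n :=
  [ffun i' => [ffun k' => if (i' == i) && (k' == k) then x else z i' k']].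

Lemma redrawE (I T : finType) (n : nat) (i : I) (k : 'I_n) (z : draw I T n)
    (x : T) (i' : I) (k' : 'I_n) :
  redraw i k z x i' k' = if (i' == i) && (k' == k) then x else z i' k'.
Proof. by rewrite !ffunE. Qed.

(* Exchanging the redrawn edge with the new value is an involution of the
   product space. *)
Lemma sum_redraw (I T : finType) (n : nat) (i : I) (k : 'I_n)
    (g : draw I T n -> nat) :
  \sum_z \sum_x g (redraw i k z x) = #|T| * \sum_z g z.
Proof.
pose swap (u : draw I T n * T) := (redraw i k u.1 u.2, u.1 i k).
have swapK : involutive swap.
  move=> [z x]; rewrite /swap /= redrawE !eqxx; congr pair.
  apply/ffunP => i'; apply/ffunP => k'; rewrite !redrawE.
  by case: andP => [[/eqP iE /eqP kE]|//]; rewrite iE kE.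
rewrite pair_big /= (reindex_inj (can_inj swapK)) /=.
rewrite (eq_bigr (fun u => g u.1)) => [|u _]; last first.
  by have /(congr1 fst)/= -> := swapK u.
rewrite -(pair_big predT predT (fun z (_ : T) => g z)) /= big_distrr /=.
by apply: eq_bigr => z _; rewrite sum_nat_const.
Qed.

Lemma sum_redraw2 (I T : finType) (n : nat) (i i' : I) (k k' : 'I_n)
    (g : draw I T n -> nat) :
  \sum_z \sum_(u : T * T) g (redraw i' k' (redraw i k z u.1) u.2) =
  #|{: T * T}| * \sum_z g z.
Proof.
under eq_bigr do
  rewrite -(pair_big predT predT
              (fun x y => g (redraw i' k' (redraw i k _ x) y))) /=.
rewrite (sum_redraw i k (fun z => \sum_y g (redraw i' k' z y))) sum_redraw.
by rewrite card_prod mulnA.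
Qed.

(** * Right vertices and right-hand pairs reached from given left vertices *)

Definition reached (I T : finType) (n : nat) (L : {set I}) (z : draw I T n) :
  {set T} := [set x | [exists l in L, [exists q, z l q == x]]].

Lemma card_reached (I T : finType) (n : nat) (L : {set I}) (z : draw I T n) :
  #|reached L z| <= #|L| * n.
Proof.
pose U := setX L [set: 'I_n].
have -> : #|L| * n = #|U| by rewrite cardsX cardsT card_ord.
apply: leq_trans (leq_imset_card (fun u => z u.1 u.2) U).
apply/subset_leq_card/subsetP => x; rewrite inE.
case/exists_inP => l lL /existsP[q /eqP <-].
by apply/imsetP; exists (l, q); rewrite // !inE lL.
Qed.

Lemma reached_redraw (I T : finType) (n : nat) (L : {set I}) (i : I)
    (k : 'I_n) (z : draw I T n) (x : T) :
  i \notin L -> reached L (redraw i k z x) = reached L z.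
Proof.
move=> iL; apply/setP => y; rewrite !inE; apply: eq_existsb => l.
case: (boolP (l \in L)) => //= lL; apply: eq_existsb => q; rewrite redrawE.
by have [lE|] := eqVneq l i; first by rewrite -lE lL in iL.
Qed.

(** Since i is not in L, redrawing an edge of i leaves [reached L z] unchanged. This set has density
    at most 2 ^ (- h K) in T, and the edges of i fall into it independently once the other edges are
    fixed. *)
Lemma reached_tail (I T : finType) (n h K : nat) (i : I) (L : {set I}) :
    0 < #|T| -> i \notin L -> 2 ^ (h * K) * (#|L| * n) <= #|T| ->
  2 ^ (K * n) *
    #|[pred z : draw I T n | n <= h * #|[set k | z i k \in reached L z]|]| <=
  2 ^ n * #|draw I T n|.
Proof.
move=> T0 iL small.
have := @card_tail_resample (draw I T n) T _ (redraw i)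
  (fun k z => z i k \in reached L z) [set: 'I_n] h K n T0.
rewrite card_ord (eq_card (B := [pred z : draw I T n |
  n <= h * #|[set k | z i k \in reached L z]|])); last first.
  by move=> z; rewrite !inE; congr (_ <= h * _); apply: eq_card => k; rewrite !inE.
apply=> [k g _|k k' z x _ _ k'k|k z _].
- exact: sum_redraw.
- by rewrite /= reached_redraw // redrawE (negPf k'k) andbF.
- apply: leq_trans small; rewrite leq_mul2l.
  rewrite (eq_card (B := mem (reached L z))) ?card_reached ?orbT // => x.
  by rewrite inE /= reached_redraw // redrawE !eqxx.
Qed.

Definition reached2 (I T : finType) (n : nat) (O : {set I * I})
    (z : draw I T n) : {set T * T} :=
  [set u | [exists b in O, [exists q : 'I_n * 'I_n,
     (z b.1 q.1 == u.1) && (z b.2 q.2 == u.2)]]].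

Lemma card_reached2 (I T : finType) (n : nat) (O : {set I * I})
    (z : draw I T n) :
  #|reached2 O z| <= #|O| * n ^ 2.
Proof.
pose U := setX O [set: 'I_n * 'I_n].
have -> : #|O| * n ^ 2 = #|U|.
  by rewrite cardsX cardsT card_prod card_ord.
apply: leq_trans (leq_imset_card (fun u => (z u.1.1 u.2.1, z u.1.2 u.2.2)) U).
apply/subset_leq_card/subsetP => -[x y]; rewrite inE /=.
case/exists_inP => b bO /existsP[q /andP[/eqP <- /eqP <-]].
by apply/imsetP; exists (b, q); rewrite // !inE bO.
Qed.

Definition avoids (I : finType) (i : I) (b : I * I) : bool :=
  (b.1 != i) && (b.2 != i).

Lemma reached2_redraw (I T : finType) (n : nat) (O : {set I * I}) (i : I)
    (k : 'I_n) (z : draw I T n) (x : T) :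
    {in O, forall b, avoids i b} ->
  reached2 O (redraw i k z x) = reached2 O z.
Proof.
move=> Oi; apply/setP => u; rewrite !inE; apply: eq_existsb => b.
case: (boolP (b \in O)) => //= /Oi/andP[/negPf bi1 /negPf bi2].
by apply: eq_existsb => q; rewrite !redrawE bi1 bi2.
Qed.

(* The edge pairs (k, r - k) with k on one side of r - k are pairwise
   disjoint even when i = i', hence independent. *)
Lemma reached2_tail (I T : finType) (n h K : nat) (i i' : I)
    (O : {set I * I}) (r : 'I_n.+1) (e : rel 'I_n.+1) :
    0 < #|T| -> {in O, forall b, avoids i b && avoids i' b} ->
    (forall k k', e k k' -> ~~ e k' k) ->
    2 ^ (h * K) * (#|O| * n.+1 ^ 2) <= #|T| ^ 2 ->
  2 ^ (K * n.+1) *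
    #|[pred z : draw I T n.+1 | n.+1 <= h * #|[set k | e k (r - k)%R &
        (z i k, z i' (r - k)%R) \in reached2 O z]|]| <=
  2 ^ n.+1 * #|draw I T n.+1|.
Proof.
move=> T0 Oii' asym small.
have Oi : {in O, forall b, avoids i b} by move=> b /Oii'/andP[].
have Oi' : {in O, forall b, avoids i' b} by move=> b /Oii'/andP[].
have e_irr k : e k k = false.
  by apply/negP => ekk; move: (asym _ _ ekk); rewrite ekk.
have TT0 : 0 < #|{: T * T}| by rewrite card_prod muln_gt0 T0.
pose B k (z : draw I T n.+1) := (z i k, z i' (r - k)%R) \in reached2 O z.
have := @card_tail_resample (draw I T n.+1) (T * T)%type 'I_n.+1
  (fun k z u => redraw i' (r - k)%R (redraw i k z u.1) u.2)
  B [set k | e k (r - k)%R] h K n.+1 TT0.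
rewrite card_ord (eq_card (B := [pred z : draw I T n.+1 |
  n.+1 <= h * #|[set k | e k (r - k)%R & B k z]|])); last first.
  move=> z; rewrite !inE; congr (_ <= h * _).
  by apply: eq_card => k; rewrite !inE.
apply=> [k g _|k k' z x|k z].
- exact: sum_redraw2.
- rewrite !inE => ek ek' k'k.
  (* When i = i', redrawing at index k changes both edges k and r - k of i. If k' were r - k, then r
     - k' would be k and [e] would hold in both directions. *)
  have k'rk : k' != (r - k)%R.
    apply/eqP => k'E; move: (asym _ _ ek); rewrite -k'E.
    by move: ek'; rewrite [in X in e _ X]k'E subKr => ->.
  have rk'k : (r - k')%R != k.
    by apply: contraNneq k'rk => <-; rewrite subKr.
  have rk'rk : (r - k')%R != (r - k)%R.
    by apply: contraNneq k'k => /(congr1 (fun t => r - t)%R); rewrite !subKr => ->.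
  rewrite /B !reached2_redraw // !redrawE.
  by rewrite (negPf k'rk) (negPf k'k) (negPf rk'k) (negPf rk'rk) !andbF.
- rewrite inE => ek; rewrite card_prod mulnn.
  apply: leq_trans small; rewrite leq_mul2l; apply/orP; right.
  rewrite (eq_card (B := mem (reached2 O z))) ?card_reached2 // => -[x y].
  rewrite !inE /B !reached2_redraw // !redrawE !eqxx /= .
  (* For i = i', the second redraw must not overwrite the first; then the pair of redrawn edges is
     exactly the new value. *)
  have /negPf -> : k != (r - k)%R.
    by apply: contraTneq ek => {2}->; rewrite subKr e_irr.
  by rewrite andbF /= !inE.
Qed.

(** * Collisions between edge pairs and their tail *)

Lemma card_antidiagonals (n : nat) (P : pred ('I_n.+1 * 'I_n.+1)) :
  #|[set u | P u]| = \sum_r #|[set k | P (k, r - k)%R]|.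
Proof.
transitivity (\sum_(k : 'I_n.+1) \sum_(k' : 'I_n.+1) P (k, k')).
  by rewrite pair_big /= cardsE card_sum_pred; apply: eq_bigr => -[].
(* Subtraction in ['I_n.+1] is modulo n + 1, so every antidiagonal is a full matching of the n + 1
   indices with themselves. *)
transitivity (\sum_(k : 'I_n.+1) \sum_(r : 'I_n.+1) P (k, r - k)%R).
  by apply: eq_bigr => k _; rewrite (reindex_inj (addIr (- k)%R)).
rewrite exchange_big; apply: eq_bigr => r _.
by rewrite cardsE card_sum_pred.
Qed.

(** The draws x and y stay separate, over possibly distinct vertex types, so that one definition
    serves both B = A, where x = y, and independent A and B. *)
Definition collisions (I I' T : finType) (n : nat) (O : {set I * I'})
    (x : draw I T n) (y : draw I' T n) (a : I * I') : {set 'I_n * 'I_n} :=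
  [set k | [exists b in O :\ a, [exists q : 'I_n * 'I_n,
     (x b.1 q.1 == x a.1 k.1) && (y b.2 q.2 == y a.2 k.2)]]].

(* The vertices other than i through which a pair of O sharing a vertex with
   (i, i') can reach the edges of i. *)
Definition near (I : finType) (O : {set I * I}) (i i' : I) : {set I} :=
  (i' |: [set l | (l, i') \in O]) :\ i.

Definition transpose (I : finType) (O : {set I * I}) : {set I * I} :=
  [set b | (b.2, b.1) \in O].

(** Let (l, l') be the colliding pair. If l = i, then l' differs from i' and lies in
    [near (transpose O) i' i]; if l' = i', then l lies in [near O i i']. In the remaining cases l =
    i' and l' = i are caught because [near] also contains its second vertex, and otherwise the pair
    avoids both i and i'. *)
Lemma collisions_cover (I T : finType) (n : nat) (O : {set I * I})
    (z : draw I T n) (i i' : I) (k k' : 'I_n) :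
    (k, k') \in collisions O z z (i, i') ->
  [|| z i k \in reached (near O i i') z,
      z i' k' \in reached (near (transpose O) i' i) z |
      (z i k, z i' k') \in
         reached2 [set b in O | avoids i b && avoids i' b] z].
Proof.
rewrite inE => /exists_inP[[l l'] /setD1P[ll' O_ll']].
case/existsP=> [[q q'] /= /andP[/eqP zq /eqP zq']].
have reach1 : l \in near O i i' -> z i k \in reached (near O i i') z.
  by move=> near_l; rewrite inE; apply/exists_inP; exists l => //;
     apply/existsP; exists q; rewrite zq.
have reach2 : l' \in near (transpose O) i' i ->
    z i' k' \in reached (near (transpose O) i' i) z.
  by move=> near_l; rewrite inE; apply/exists_inP; exists l' => //;
     apply/existsP; exists q'; rewrite zq'.
have [/reach1 -> //|far1] := boolP (l \in near O i i').
have [/reach2 ->|far2] := boolP (l' \in near (transpose O) i' i).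
  by rewrite orbT.
apply/orP; right; apply/orP; right; rewrite inE; apply/exists_inP.
exists (l, l'); last by apply/existsP; exists (q, q'); rewrite zq zq' !eqxx.
move: ll' far1 far2; rewrite !inE O_ll' /avoids xpair_eqE /=.
have [lE|li] := eqVneq l i; have [l'E|l'i'] := eqVneq l' i'; subst => //=;
  rewrite ?O_ll' ?orbT ?andbT ?andbF //=.
by case: eqP => //=; case: eqP => //=.
Qed.

Lemma card_near (I : finType) (O : {set I * I}) (d : nat) (i i' : I) :
  #|[set l | (l, i') \in O]| <= d -> #|near O i i'| <= d.+1.
Proof.
move=> le_d; apply: leq_trans (subset_leq_card (subsetDl _ _)) _.
by rewrite cardsU1 -add1n leq_add // leq_b1.
Qed.

(** The two strict orders between k and k' are treated separately, each being asymmetric as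
    [reached2_tail] requires; the diagonal is left over. *)
Definition side (n : nat) (b : bool) : rel 'I_n :=
  fun k k' => if b then k < k' else k' < k.

(** With N = n + 1, the two sets of single edges and the two sides of the diagonal contribute at
    most N^2 / 16 each, and the diagonal, counted in full, at most N <= N^2 / 12. The total is at
    most (4 / 16 + 1 / 12) N^2 = N^2 / 3. *)
Lemma card_collisions (I T : finType) (n : nat) (O : {set I * I})
    (z : draw I T n.+1) (i i' : I) :
    12 <= n.+1 ->
    16 * #|[set k | z i k \in reached (near O i i') z]| < n.+1 ->
    16 * #|[set k | z i' k \in reached (near (transpose O) i' i) z]| < n.+1 ->
    (forall (r : 'I_n.+1) (b : bool),
       16 * #|[set k : 'I_n.+1 | side b k (r - k)%R &
         (z i k, z i' (r - k)%R) \in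
           reached2 [set b in O | avoids i b && avoids i' b] z]| < n.+1) ->
  3 * #|collisions O z z (i, i')| <= n.+1 ^ 2.
Proof.
move=> n12; set S1 := [set k | _]; set S2 := [set k | _].
set O' := [set b in O | _] => le1 le2 le3.
pose F (b : bool) := [set u : 'I_n.+1 * 'I_n.+1 |
  side b u.1 u.2 & (z i u.1, z i' u.2) \in reached2 O' z].
have leF b : 16 * #|F b| <= n.+1 * n.+1.
  rewrite card_antidiagonals big_distrr /=.
  apply: (@leq_trans (\sum_(r : 'I_n.+1) n.+1)); last by rewrite sum_nat_const card_ord.
  by apply: leq_sum => r _; apply/ltnW/(le3 r b).
pose D := [set (k, k) | k : 'I_n.+1].
have leD : #|D| <= n.+1 by rewrite -[X in _ <= X]card_ord leq_imset_card.
pose U := setX S1 setT :|: setX setT S2 :|: D :|: F true :|: F false.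
have sub : collisions O z z (i, i') \subset U.
  apply/subsetP => -[k k'] /collisions_cover.
  rewrite !inE /side /= -/O' => /or3P[-> //|->|far]; rewrite ?orbT ?andbT //.
  have [eqk|ltk|ltk] := ltngtP k k'.
  - by rewrite far !orbT.
  - by rewrite far !orbT.
  - suff -> : (k, k') \in D by rewrite !orbT.
    by apply/imsetP; exists k => //; congr pair; apply/val_inj.
have leU : #|U| <= #|S1| * n.+1 + n.+1 * #|S2| + #|D| + #|F true| + #|F false|.
  have eqX1 : #|setX S1 [set: 'I_n.+1]| = #|S1| * n.+1.
    by rewrite cardsX cardsT card_ord.
  have eqX2 : #|setX [set: 'I_n.+1] S2| = n.+1 * #|S2|.
    by rewrite cardsX cardsT card_ord.
  rewrite -eqX1 -eqX2.
  do 3![apply: leq_trans (leq_card_setU _ _) _; rewrite leq_add2r].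
  exact: leq_card_setU.
have := leq_trans (subset_leq_card sub) leU.
move: (leF true) (leF false); nia.
Qed.

(** A union bound over 2 + 2 (n + 1) events: one for the edges of each of i and i', and one for each
    antidiagonal and each side of the diagonal. *)
Lemma collisions_tail (I T : finType) (n d K : nat) (O : {set I * I})
    (i i' : I) :
    0 < #|T| -> 12 <= n.+1 ->
    #|[set l | (l, i') \in O]| <= d -> #|[set l | (i, l) \in O]| <= d ->
    2 ^ (16 * K) * (d.+1 * n.+1) <= #|T| ->
    2 ^ (16 * K) * (#|O| * n.+1 ^ 2) <= #|T| ^ 2 ->
  2 ^ (K * n.+1) * #|[pred z : draw I T n.+1 |
      n.+1 ^ 2 < 3 * #|collisions O z z (i, i')|]| <=
  (2 + 2 * n.+1) * (2 ^ n.+1 * #|draw I T n.+1|).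
Proof.
move=> T0 n12 dcol drow small1 small2.
have small3 (L : {set I}) : #|L| <= d.+1 ->
    2 ^ (16 * K) * (#|L| * n.+1) <= #|T|.
  by move=> leL; apply: leq_trans small1; rewrite leq_mul2l leq_mul ?orbT.
pose O' := [set b in O | avoids i b && avoids i' b].
have small4 : 2 ^ (16 * K) * (#|O'| * n.+1 ^ 2) <= #|T| ^ 2.
  apply: leq_trans small2; rewrite leq_mul2l leq_mul ?orbT // subset_leq_card //.
  by apply/subsetP => b; rewrite inE => /andP[].
pose E1 (z : draw I T n.+1) :=
  n.+1 <= 16 * #|[set k | z i k \in reached (near O i i') z]|.
pose E2 (z : draw I T n.+1) :=
  n.+1 <= 16 * #|[set k | z i' k \in reached (near (transpose O) i' i) z]|.
pose E3 r b (z : draw I T n.+1) := n.+1 <= 16 *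
  #|[set k : 'I_n.+1 | side b k (r - k)%R &
     (z i k, z i' (r - k)%R) \in reached2 O' z]|.
have tail1 : 2 ^ (K * n.+1) * #|[pred z | E1 z]| <= 2 ^ n.+1 * #|draw I T n.+1|.
  by apply: reached_tail; rewrite ?setD11 ?small3 // card_near.
have tail2 : 2 ^ (K * n.+1) * #|[pred z | E2 z]| <= 2 ^ n.+1 * #|draw I T n.+1|.
  apply: reached_tail; rewrite ?setD11 ?small3 // card_near //.
  by apply: leq_trans drow; apply/subset_leq_card/subsetP => l; rewrite !inE.
have tail3 r b : 2 ^ (K * n.+1) * #|[pred z | E3 r b z]| <=
    2 ^ n.+1 * #|draw I T n.+1|.
  apply: reached2_tail => // [c|k k']; first by rewrite inE => /andP[].
  by rewrite /side; case: b; rewrite -leqNgt => /ltnW.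
pose bad (z : draw I T n.+1) := n.+1 ^ 2 < 3 * #|collisions O z z (i, i')|.
have cover : #|[pred z | bad z]| <=
    #|[pred z | E1 z]| + #|[pred z | E2 z]| +
    \sum_(u : 'I_n.+1 * bool) #|[pred z | E3 u.1 u.2 z]|.
  under eq_bigr do rewrite card_sum_pred.
  rewrite exchange_big !card_sum_pred -!big_split /=; apply: leq_sum => z _.
  case badz: (bad z) => //; rewrite lt0n; apply: contraTneq badz => /eqP.
  rewrite !addn_eq0 sum_nat_eq0 !eqb0 -!ltnNge -andbA.
  case/and3P=> E1z E2z /forall_inP E3z.
  rewrite ltnS; apply: card_collisions => // r b.
  by have := E3z (r, b) isT; rewrite eqb0 -ltnNge.
apply: leq_trans (leq_mul (leqnn _) cover) _.
rewrite !mulnDr !mulnDl mul2n -addnn leq_add ?leq_add // big_distrr /=.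
apply: (@leq_trans (\sum_(u : 'I_n.+1 * bool) 2 ^ n.+1 * #|draw I T n.+1|)).
  by apply: leq_sum => -[r b] _; apply: tail3.
by rewrite sum_nat_const card_prod card_ord card_bool [_ * 2]mulnC.
Qed.

Lemma few_collisions (I T : finType) (n d K : nat) (O : {set I * I}) :
    0 < #|T| -> 12 <= n ->
    (forall i, #|[set l | (l, i) \in O]| <= d) ->
    (forall i, #|[set l | (i, l) \in O]| <= d) ->
    2 ^ (16 * K) * (d.+1 * n) <= #|T| ->
    2 ^ (16 * K) * (#|O| * n ^ 2) <= #|T| ^ 2 ->
  2 ^ (K * n) * #|[pred z : draw I T n |
      [exists a, n ^ 2 < 3 * #|collisions O z z a|]]| <=
  2 * #|I| ^ 2 * 2 ^ (2 * n) * #|draw I T n|.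
Proof.
case: n => // n T0 n12 dcol drow small1 small2.
pose bad a (z : draw I T n.+1) := n.+1 ^ 2 < 3 * #|collisions O z z a|.
have cover : #|[pred z | [exists a, bad a z]]| <=
    \sum_a #|[pred z | bad a z]|.
  under eq_bigr do rewrite card_sum_pred.
  rewrite exchange_big card_sum_pred; apply: leq_sum => z _.
  by case: existsP => // -[a bad_a]; rewrite (bigD1 a) //= bad_a.
apply: leq_trans (leq_mul (leqnn _) cover) _; rewrite big_distrr /=.
apply: (@leq_trans (\sum_(a : I * I) 2 * 2 ^ (2 * n.+1) * #|draw I T n.+1|)).
  apply: leq_sum => -[i i'] _.
  apply: leq_trans (collisions_tail T0 n12 (dcol i') (drow i) small1 small2) _.
  (* The number of events is absorbed by n.+2 <= 2 ^ n.+1, whence the second factor 2 ^ n in the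
     bound. *)
  have -> : 2 + 2 * n.+1 = 2 * n.+2 by lia.
  rewrite [2 * n.+1]mul2n -addnn expnD -!mulnA leq_mul2l leq_mul2r.
  by rewrite ltn_expl ?orbT.
by apply: eq_leq; rewrite sum_nat_const card_prod; ring.
Qed.

(** * Deterministic recovery: null space property and l1 error *)

Local Open Scope ring_scope.

(** If a is the only index of O present in equation r, that equation bounds [M a r * |V a|] by the
    terms outside O, and every b outside O present there collides with a. Summed over r, each a in O
    keeps weight at least 2 D / 3 on the left, while each b outside O has weight at most D / 3 on
    the right. *)
Lemma null_space_property (R : realFieldType) (P Q : finType) (M : P -> Q -> R)
    (O : {set P}) (V : P -> R) (D : R) :
    0 < D -> (forall a r, 0 <= M a r) ->
    (forall r, \sum_a M a r * V a = 0) ->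
    (forall a, \sum_r M a r = D) ->
    (forall a, 3 * \sum_(r | [exists b in O :\ a, M b r != 0]) M a r <= D) ->
  2 * \sum_(a in O) `|V a| <= \sum_(a | a \notin O) `|V a|.
Proof.
move=> D0 M0 MV0 MD few.
pose hit a r := [exists b in O :\ a, M b r != 0].
have isolated r : \sum_(a in O | ~~ hit a r) M a r * `|V a| <=
    \sum_(b | (b \notin O) && hit b r) M b r * `|V b|.
  have R0 : 0 <= \sum_(b | (b \notin O) && hit b r) M b r * `|V b|.
    by apply: sumr_ge0 => b _; rewrite mulr_ge0.
  have [/existsP[a /and3P[aO nhit_a Ma]]|none] :=
      boolP [exists a, [&& a \in O, ~~ hit a r & M a r != 0]]; last first.
    rewrite big1 // => a /andP[aO nhit_a].
    move: none; rewrite negb_exists => /forallP/(_ a).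
    by rewrite aO nhit_a /= negbK => /eqP->; rewrite mul0r.
  have Mb0 b : b \in O -> b != a -> M b r = 0.
    move=> bO ba; move: nhit_a; rewrite negb_exists => /forallP/(_ b).
    by rewrite !inE ba bO /= negbK => /eqP.
  have hitb b : b \notin O -> hit b r.
    move=> bO; apply/exists_inP; exists a => //; rewrite !inE aO andbT.
    by apply: contraNneq bO => <-.
  rewrite (bigD1 a) /=; last by rewrite aO.
  rewrite [X in _ + X]big1 ?addr0 => [|b /andP[/andP[bO _] ba]]; last first.
    by rewrite Mb0 // mul0r.
  rewrite (eq_bigl (fun b => b \notin O)) => [|b]; last first.
    by apply: andb_idr => /hitb.
  have : M a r * V a = - \sum_(b | b \notin O) M b r * V b.
    have := MV0 r; rewrite (bigID (mem O)) /= (bigD1 a) //=.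
    rewrite [X in _ + X + _]big1 ?addr0 => [/eqP|b /andP[bO ba]].
      by rewrite addr_eq0 => /eqP.
    by rewrite Mb0 // mul0r.
  rewrite -[in M a r * `|V a|](ger0_norm (M0 a r)) -normrM => ->.
  rewrite normrN; apply: le_trans (ler_norm_sum _ _ _) _.
  by apply: ler_sum => b _; rewrite normrM ger0_norm.
have : \sum_(a in O) `|V a| * \sum_(r | ~~ hit a r) M a r <=
    \sum_(b | b \notin O) `|V b| * \sum_(r | hit b r) M b r.
  under eq_bigr do rewrite mulr_sumr.
  under [X in _ <= X]eq_bigr do rewrite mulr_sumr.
  rewrite (exchange_big_dep predT) //= [X in _ <= X](exchange_big_dep predT) //=.
  apply: ler_sum => r _; under eq_bigr do rewrite mulrC.
  by under [X in _ <= X]eq_bigr do rewrite mulrC.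
have lo : \sum_(a in O) `|V a| * (D * 2 / 3) <=
    \sum_(a in O) `|V a| * \sum_(r | ~~ hit a r) M a r.
  apply: ler_sum => a _; apply: ler_wpM2l => //.
  by have := MD a; rewrite (bigID (hit a)) /=; have := few a; rewrite -/(hit a); lra.
have up : \sum_(b | b \notin O) `|V b| * \sum_(r | hit b r) M b r <=
    \sum_(b | b \notin O) `|V b| * (D / 3).
  apply: ler_sum => a _; apply: ler_wpM2l => //.
  by have := few a; rewrite -/(hit a); lra.
move=> /(le_trans lo)/le_trans/(_ up); rewrite -!mulr_suml => le_D.
rewrite -(ler_pM2r (_ : 0 < D / 3)); last by lra.
by apply: le_trans le_D; lra.
Qed.

(** Let S and T be the errors on and off O, and s the mass of X off O. The triangle inequality and
    the minimality of Y give T - S <= 2 s; with 2 S <= T this yields T <= 4 s and S <= 2 s. *)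
Lemma l1_error (R : realFieldType) (P : finType) (O : {set P}) (X Y : P -> R) :
    \sum_a `|Y a| <= \sum_a `|X a| ->
    2 * \sum_(a in O) `|Y a - X a| <= \sum_(a | a \notin O) `|Y a - X a| ->
  \sum_a `|Y a - X a| <= 6 * \sum_(a | a \notin O) `|X a|.
Proof.
rewrite (bigID (mem O)) /= [X in _ <= X -> _](bigID (mem O)) /=.
rewrite [X in _ -> _ -> X <= _](bigID (mem O)) /=.
have le1 : \sum_(a in O) `|X a| - \sum_(a in O) `|Y a - X a| <=
    \sum_(a in O) `|Y a|.
  rewrite -sumrB; apply: ler_sum => a _.
  by rewrite lerBlDr -{1}[X a](subKr (Y a)) ler_normB.
have le2 : \sum_(a | a \notin O) `|Y a - X a| - \sum_(a | a \notin O) `|X a| <=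
    \sum_(a | a \notin O) `|Y a|.
  by rewrite -sumrB; apply: ler_sum => a _; rewrite lerBlDr ler_normB.
by move: le1 le2; lra.
Qed.

(** * From collision counts to recovery by the ensemble matrices *)

Lemma l1normE (R : realType) (m n : nat) (M : 'M[R]_(m, n)) :
  l1norm M = \sum_u `|M u.1 u.2|.
Proof. by rewrite /l1norm pair_big. Qed.

Lemma l1norm_restrict (R : realType) (p : nat) (O : {set 'I_p * 'I_p})
    (X : 'M[R]_p) :
  l1norm (X - mxrestrict O X) = \sum_(u | u \notin O) `|X u.1 u.2|.
Proof.
rewrite l1normE [RHS]big_mkcond /=; apply: eq_bigr => -[i j] _ /=.
by rewrite !mxE; case: ifP => _; rewrite ?subrr ?subr0 ?normr0.
Qed.

Lemma ensemble_mxM (R : realType) (m p n : nat) (x y : edge_draw m p n)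
    (i i' : 'I_p) (r : 'I_m * 'I_m) :
  ensemble_mx R x r.1 i * ensemble_mx R y r.2 i' =
  #|[set k : 'I_n * 'I_n | (x i k.1, y i' k.2) == r]|%:R.
Proof.
case: r => r1 r2; rewrite !mxE -natrM -cardsX; congr (_%:R); apply: eq_card => k.
by rewrite !inE xpair_eqE.
Qed.

(** This turns the weights in the null space property into numbers of edge pairs, counted with
    multiplicity. *)
Lemma sum_ensemble_mxM (R : realType) (m p n : nat) (x y : edge_draw m p n)
    (i i' : 'I_p) (h : pred ('I_m * 'I_m)) :
  \sum_(r | h r) ensemble_mx R x r.1 i * ensemble_mx R y r.2 i' =
  #|[set k : 'I_n * 'I_n | h (x i k.1, y i' k.2)]|%:R.
Proof.
under eq_bigr do rewrite ensemble_mxM; rewrite -natr_sum; congr (_%:R).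
rewrite -sum1_card.
rewrite (partition_big (fun k : 'I_n * 'I_n => (x i k.1, y i' k.2)) h) /=.
  apply: eq_bigr => r hr; rewrite -sum1_card; apply: eq_bigl => k.
  by rewrite !inE; case: eqP => [->|]; rewrite ?hr ?andbF.
by move=> k; rewrite inE.
Qed.

Lemma few_collisions_recovery (R : realType) (d m p n : nat)
    (O : {set 'I_p * 'I_p}) (X : 'M[R]_p) (x y : edge_draw m p n) :
    (0 < n)%N -> best_approx_err d X = l1norm (X - mxrestrict O X) ->
    (forall a, 3 * #|collisions O x y a| <= n ^ 2)%N ->
  l1_recovery d (1 / 5) X (ensemble_mx R x) (ensemble_mx R y).
Proof.
move=> n0 errE few Y [eqY /(_ X erefl)]; rewrite !l1normE errE l1norm_restrict.
set A := ensemble_mx R x; set B := ensemble_mx R y => leYX.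
have -> : (2 - 4 * (1 / 5)) / (1 - 4 * (1 / 5)) = 6 :> R.
  by have -> : 1 - 4 * (1 / 5) = 5^-1 :> R; [lra|rewrite invrK; lra].
under eq_bigr do rewrite !mxE.
apply: (@l1_error R _ O (fun u => X u.1 u.2) (fun u => Y u.1 u.2)) => //.
(* The Kronecker product of A and B; each of its columns sums to n ^ 2, the number of edge pairs of
   a. *)
pose M (a : 'I_p * 'I_p) (r : 'I_m * 'I_m) := A r.1 a.1 * B r.2 a.2.
apply: (@null_space_property R _ _ M O _ (n ^ 2)%:R).
- by rewrite ltr0n expn_gt0 n0.
- by move=> a r; rewrite /M ensemble_mxM.
- move=> r; transitivity ((A *m Y *m B^T - A *m X *m B^T) r.1 r.2); last first.
    by rewrite eqY subrr mxE.
  rewrite -mulmxBl -mulmxBr !mxE.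
  under [RHS]eq_bigr do rewrite !mxE mulr_suml.
  rewrite exchange_big pair_big /=; apply: eq_bigr => -[i j] _ /=.
  by rewrite /M mulrAC !mxE.
- move=> a; rewrite (sum_ensemble_mxM R x y a.1 a.2 predT); congr (_%:R).
  rewrite (eq_card (B := predT)) => [|k]; last by rewrite inE.
  by rewrite card_prod card_ord mulnn.
move=> a; rewrite (sum_ensemble_mxM R x y a.1 a.2) -natrM ler_nat.
apply: leq_trans (few a); rewrite leq_mul2l; apply/orP; right.
apply/subset_leq_card/subsetP => k; rewrite !inE => /exists_inP[b bO].
rewrite /M ensemble_mxM pnatr_eq0 cards_eq0 => /set0Pn[q].
rewrite inE xpair_eqE => eq_q.
by apply/exists_inP; exists b => //; apply/existsP; exists q.
Qed.

(** * Sizes of distributed supports *)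

Lemma distributed_row (d p : nat) (O : {set 'I_p * 'I_p}) (i : 'I_p) :
  O \in distributed d p -> (#|[set l | (i, l) \in O]| <= d)%N.
Proof.
rewrite inE => /forallP/(_ i)/andP[row _]; apply: leq_trans row.
rewrite -(card_imset _ (can_inj (fun l => erefl : (i, l).2 = l))).
apply/subset_leq_card/subsetP => _ /imsetP[l lO ->].
by rewrite inE in lO; rewrite !inE lO /= eqxx.
Qed.

Lemma distributed_col (d p : nat) (O : {set 'I_p * 'I_p}) (i : 'I_p) :
  O \in distributed d p -> (#|[set l | (l, i) \in O]| <= d)%N.
Proof.
rewrite inE => /forallP/(_ i)/andP[_ col]; apply: leq_trans col.
rewrite -(card_imset _ (can_inj (fun l => erefl : (l, i).1 = l))).
apply/subset_leq_card/subsetP => _ /imsetP[l lO ->].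
by rewrite inE in lO; rewrite !inE lO /= eqxx.
Qed.

Lemma card_distributed (d p : nat) (O : {set 'I_p * 'I_p}) :
  O \in distributed d p -> (#|O| <= d * p)%N.
Proof.
move=> Odp; have -> : #|O| = (\sum_i #|[set l | (i, l) \in O]|)%N.
  transitivity (\sum_i \sum_l ((i, l) \in O))%N.
    by rewrite pair_big -card_sum_pred; apply: eq_card => -[].
  by apply: eq_bigr => i _; rewrite cardsE card_sum_pred.
apply: (@leq_trans (\sum_(i < p) d)); last first.
  by rewrite sum_nat_const card_ord mulnC.
by apply: leq_sum => i _; apply: distributed_row.
Qed.

(** * Two independent draws, and the failure count *)

Local Open Scope nat_scope.

(* Two independent draws are a single draw on the disjoint union of the two
   vertex sets. *)
Lemma few_collisions_pair (I I' T : finType) (n d K : nat)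
    (O : {set I * I'}) :
    0 < #|T| -> 12 <= n ->
    (forall i, #|[set l | (l, i) \in O]| <= d) ->
    (forall i, #|[set l | (i, l) \in O]| <= d) ->
    2 ^ (16 * K) * (d.+1 * n) <= #|T| ->
    2 ^ (16 * K) * (#|O| * n ^ 2) <= #|T| ^ 2 ->
  2 ^ (K * n) * #|[pred w : draw I T n * draw I' T n |
      [exists a, n ^ 2 < 3 * #|collisions O w.1 w.2 a|]]| <=
  2 * (#|I| + #|I'|) ^ 2 * 2 ^ (2 * n) * #|{: draw I T n * draw I' T n}|.
Proof.
move=> T0 n12 dcol drow small1 small2.
pose emb (u : I * I') : (I + I') * (I + I') := (inl u.1, inr u.2).
have emb_inj : injective emb by move=> [i i'] [j j'] [-> ->].
pose f (z : draw (I + I')%type T n) : draw I T n * draw I' T n :=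
  ([ffun i => z (inl i)], [ffun i => z (inr i)]).
pose g (w : draw I T n * draw I' T n) : draw (I + I')%type T n :=
  [ffun s => match s with inl i => w.1 i | inr i => w.2 i end].
have fK : cancel f g.
  by move=> z; apply/ffunP => -[i|i]; rewrite !ffunE.
have gK : cancel g f.
  by move=> [x y]; congr pair; apply/ffunP => i; rewrite !ffunE.
have f_bij : bijective f by exists g.
(* The [inl] vertices carry the first draw and the [inr] vertices the second, so a collision between
   the two draws is one of z on the embedded support. *)
have fold_coll z a : #|collisions O (f z).1 (f z).2 a| <=
    #|collisions [set emb b | b in O] z z (emb a)|.
  apply/subset_leq_card/subsetP => k; rewrite !inE.
  case/exists_inP=> b /setD1P[ba bO] /existsP[q]; rewrite !ffunE => eq_q.
  apply/exists_inP; exists (emb b); last by apply/existsP; exists q.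
  by rewrite !inE (inj_eq emb_inj) ba imset_f.
have -> : #|{: draw I T n * draw I' T n}| = #|draw (I + I')%type T n|.
  by apply/esym/bij_eq_card/f_bij.
have colE i : #|[set l | (l, i) \in [set emb b | b in O]]| <= d.
  case: i => i.
    by rewrite eq_card0 // => l; rewrite inE; apply/imsetP => -[].
  apply: leq_trans (dcol i); apply: leq_trans (leq_imset_card inl _).
  apply/subset_leq_card/subsetP => l; rewrite inE => /imsetP[[j j'] jO [-> ->]].
  by rewrite imset_f // inE.
have rowE i : #|[set l | (i, l) \in [set emb b | b in O]]| <= d.
  case: i => i; last first.
    by rewrite eq_card0 // => l; rewrite inE; apply/imsetP => -[].
  apply: leq_trans (drow i); apply: leq_trans (leq_imset_card inr _).
  apply/subset_leq_card/subsetP => l; rewrite inE => /imsetP[[j j'] jO [-> ->]].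
  by rewrite imset_f // inE.
rewrite -(card_imset _ emb_inj) in small2.
have := few_collisions T0 n12 colE rowE small1 small2.
rewrite card_sum; apply: leq_trans; rewrite leq_mul2l; apply/orP; right.
pose bad (w : draw I T n * draw I' T n) :=
  [exists a, n ^ 2 < 3 * #|collisions O w.1 w.2 a|].
rewrite (card_sum_pred bad) (reindex f); last exact: onW_bij.
rewrite card_sum_pred; apply: leq_sum => z _; rewrite /bad.
case: existsP => // -[a bad_a]; rewrite lt0b; apply/existsP; exists (emb a).
by apply: leq_trans bad_a _; rewrite leq_mul2l fold_coll orbT.
Qed.

(** This is where K = 6 comes from: cancelling 2 ^ (2 * n) leaves 2 ^ (4 * n) >= p ^ 4 against 2 (2
    p)^2 = 8 p^2. Hence p^2 f <= 8 Z < p Z. *)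
Lemma failure_bound (p n f Z : nat) :
    9 <= p -> p <= 2 ^ n -> 0 < Z ->
    2 ^ (6 * n) * f <= 2 * (p + p) ^ 2 * 2 ^ (2 * n) * Z ->
  p * f < Z.
Proof.
move=> p9 pn Z0.
have -> : 6 * n = n * 4 + 2 * n by lia.
rewrite expnD mulnAC [X in _ <= X]mulnAC leq_pmul2r ?expn_gt0 // expnM => le_f.
have : p ^ 4 * f <= 2 * (p + p) ^ 2 * Z.
  by apply: leq_trans le_f; rewrite leq_mul2r leq_exp2r // pn orbT.
have -> : p ^ 4 * f = p ^ 2 * (p ^ 2 * f) by ring.
have -> : 2 * (p + p) ^ 2 * Z = p ^ 2 * (8 * Z) by ring.
rewrite leq_pmul2l ?expn_gt0 ?(leq_trans _ p9) // => le_f2.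
have p0 : 0 < p by apply: leq_trans p9.
rewrite -(ltn_pmul2l p0) mulnA mulnn; apply: leq_ltn_trans le_f2 _.
by rewrite ltn_pmul2r.
Qed.

(** * Probabilities, choice of parameters and conclusion *)

Local Open Scope ring_scope.

Lemma unifPr_gt (R : realType) (T : finType) (E : T -> Prop) (bad : pred T)
    (p : nat) :
    (0 < p)%N -> (forall w, ~~ bad w -> E w) ->
    (p * #|[pred w | bad w]| < #|T|)%N ->
  1 - p%:R `^ (- 1) < unifPr R E.
Proof.
move=> p0 goodE lt_bad; rewrite powR_inv1 ?ler0n // /unifPr.
have T0 : 0 < #|T|%:R :> R by rewrite ltr0n; apply: leq_ltn_trans lt_bad.
have p0R : 0 < p%:R :> R by rewrite ltr0n.
have le_T : (#|T| <= #|[pred w | `[< E w >]]| + #|[pred w | bad w]|)%N.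
  rewrite -(cardC [pred w | bad w]) addnC leq_add2r.
  apply/subset_leq_card/subsetP => w; rewrite !inE => good_w.
  exact/asboolP/goodE.
rewrite ltr_pdivlMr //; move: lt_bad le_T; rewrite -(ltr_nat R) -(ler_nat R).
rewrite natrM natrD => lt_bad le_T.
have : #|[pred w | bad w]|%:R < #|T|%:R / p%:R :> R.
  by rewrite ltr_pdivlMr // mulrC.
by move: le_T; rewrite mulrBl mul1r [_^-1 * _]mulrC; lra.
Qed.

Lemma nceil_itv (R : realType) (x : R) :
  0 <= x -> x <= (nceil x)%:R <= x + 1.
Proof.
move=> x0; have c0 : 0 <= Num.ceil x by rewrite ceil_ge0 (lt_le_trans _ x0) ?ltrN10.
have -> : (nceil x)%:R = (Num.ceil x)%:~R :> R.
  by rewrite /nceil natr_absz ger0_norm.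
rewrite ceil_ge /= -lerBlDr; apply/ltW.
by have := ceilB1_lt x; rewrite intrB.
Qed.

(** With L = log_2 p, S = 2 ^ (8 K) and s = sqrt (d p), everything about m follows from m >= S s
    delta: its square is the last bound, and s >= (d + 1) S turns it into the fourth. *)
Lemma sketch_parameters (R : realType) (d K : nat) :
    (1 <= d)%N ->
  exists p0 : nat, forall p : nat, (p0 <= p)%N ->
    let delta := nceil ((ln 2)^-1 * ln p%:R : R) in
    let m := nceil (2 * (ln 2)^-1 * 2 ^+ (8 * K) *
               Num.sqrt (d%:R * p%:R) * ln p%:R : R) in
    [/\ (9 <= p)%N, (12 <= delta)%N, (p <= 2 ^ delta)%N,
        (2 ^ (16 * K) * (d.+1 * delta) <= m)%N &
        (2 ^ (16 * K) * (d * p * delta ^ 2) <= m ^ 2)%N].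
Proof.
(* The first threshold gives L >= 12, hence delta >= 12; the second gives s^2 >= p >= ((d + 1)
   S)^2. *)
move=> d0; exists (maxn (2 ^ 12) ((d.+1 * 2 ^ (8 * K)) ^ 2)).
move=> p; rewrite geq_max => /andP[p12 pd] delta m.
have p9 : (9 <= p)%N by apply: leq_trans p12.
have p0 : (0 < p)%N by apply: leq_trans p9.
have ln2_gt0 : 0 < ln 2 :> R by rewrite ln_gt0 // ltr1n.
pose L : R := (ln 2)^-1 * ln p%:R.
have lnpE : ln p%:R = L * ln 2 by rewrite /L mulrAC mulVf ?mul1r ?gt_eqF.
have L12 : 12 <= L.
  rewrite -(ler_pM2r ln2_gt0) -lnpE mulr_natl -lnXn ?ltr0n //.
  by rewrite ler_ln ?posrE ?exprn_gt0 ?ltr0n // -natrX ler_nat.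
have /andP[L_le le_L1] : L <= delta%:R <= L + 1.
  by apply: nceil_itv; apply: le_trans L12.
have L0 : 0 <= L by apply: le_trans L12.
pose s := Num.sqrt (d%:R * p%:R : R).
pose S : R := 2 ^+ (8 * K).
have S0 : 0 < S by rewrite exprn_gt0.
have S_ge0 := ltW S0.
have SS : (2 ^ (16 * K))%:R = S ^+ 2 :> R.
  by rewrite natrX -exprM; congr (_ ^+ _); lia.
have s0 : 0 <= s by rewrite sqrtr_ge0.
have ss : s ^+ 2 = d%:R * p%:R by rewrite sqr_sqrtr // mulr_ge0.
have m_ge : S * s * delta%:R <= m%:R.
  have /andP[+ _] : 2 * S * s * L <= m%:R <= 2 * S * s * L + 1.
    have -> : m = nceil (2 * S * s * L).
      by rewrite /m -/s -/S /L; congr nceil; ring.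
    by apply: nceil_itv; do 3!rewrite mulr_ge0 //.
  (* The factor 2 in m absorbs the rounding of delta: delta <= L + 1 <= 2 L. *)
  apply: le_trans; have -> : 2 * S * s * L = S * s * (2 * L) by ring.
  by apply: ler_wpM2l; [rewrite mulr_ge0|lra].
have s_ge : d.+1%:R * S <= s.
  rewrite -(ler_pXn2r (_ : 0 < 2)%N) ?nnegrE ?mulr_ge0 // ss.
  apply: (@le_trans _ _ p%:R); last by rewrite ler_peMl // ler1n.
  by rewrite /S -natrX -natrM -natrX ler_nat.
have delta0 : 0 <= delta%:R :> R by [].
split=> //.
- by rewrite -(ler_nat R) (le_trans L12).
- rewrite -(ler_nat R) -ler_ln ?posrE ?ltr0n ?expn_gt0 //.
  by rewrite natrX lnXn ?ltr0n // lnpE -[_ *+ delta]mulr_natl ler_wpM2r // ltW.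
- rewrite -(ler_nat R) !natrM SS; apply: le_trans m_ge.
  have -> : S ^+ 2 * (d.+1%:R * delta%:R) = S * (d.+1%:R * S) * delta%:R by ring.
  by rewrite ler_wpM2r // ler_wpM2l.
- rewrite -(ler_nat R) [X in _ <= X]natrX natrM SS natrM [(delta ^ 2)%:R]natrX natrM -ss.
  have -> : S ^+ 2 * (s ^+ 2 * delta%:R ^+ 2) = (S * s * delta%:R) ^+ 2 by ring.
  by rewrite ler_pXn2r // nnegrE ?mulr_ge0.
Qed.

Theorem theorem2 (R : realType) :
  exists C1 C2 c eps : R,
    [/\ 0 < C1, 0 < C2, 0 < c & 0 < eps < 1 / 4] /\
    forall d : nat, (1 <= d)%N ->
    exists p0 : nat, forall p : nat, (p0 <= p)%N ->
    let delta := nceil (C1 * ln p%:R) in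
    let m := nceil (C2 * Num.sqrt (d%:R * p%:R) * ln p%:R) in
    forall X : 'M[R]_p,
      1 - p%:R `^ (- c) <
        unifPr R (fun w : edge_draw m p delta * edge_draw m p delta =>
          l1_recovery d eps X (ensemble_mx R w.1) (ensemble_mx R w.2)) /\
      1 - p%:R `^ (- c) <
        unifPr R (fun w : edge_draw m p delta =>
          l1_recovery d eps X (ensemble_mx R w) (ensemble_mx R w)).
Proof.
have ln2_gt0 : 0 < ln 2 :> R by rewrite ln_gt0 // ltr1n.
(* The choice of C1 makes delta the ceiling of log_2 p. The exponent is 8 * 6, half of 16 * 6,
   because the density of the reached pairs is measured against m ^ 2. *)
exists (ln 2)^-1, (2 * (ln 2)^-1 * 2 ^+ (8 * 6)), 1, (1 / 5); split.
  by split; rewrite ?mulr_gt0 ?invr_gt0 ?exprn_gt0 //; lra.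
move=> d d0; have [p0 params] := sketch_parameters R 6 d0.
exists p0 => p p0p delta m X.
have := params p p0p; rewrite -/delta -/m => -[p9 delta12 p_le small1 small2].
have p_gt0 : (0 < p)%N by apply: leq_trans p9.
have delta_gt0 : (0 < delta)%N by apply: leq_trans delta12.
have m_gt0 : (0 < m)%N.
  by apply: leq_trans small1; rewrite muln_gt0 expn_gt0 muln_gt0 delta_gt0.
have draw_gt0 : (0 < #|edge_draw m p delta|)%N.
  by rewrite !card_ffun !card_ord !expn_gt0 m_gt0.
have [[O Odp errE] _] := best_approx_errP d X.
have T0 : (0 < #|'I_m|)%N by rewrite card_ord.
have col i := distributed_col i Odp.
have row i := distributed_row i Odp.
have small1T : (2 ^ (16 * 6) * (d.+1 * delta) <= #|'I_m|)%N by rewrite card_ord.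
have small2T : (2 ^ (16 * 6) * (#|O| * delta ^ 2) <= #|'I_m| ^ 2)%N.
  rewrite card_ord; apply: leq_trans small2; rewrite leq_mul2l.
  by rewrite leq_mul ?orbT // card_distributed.
split.
  apply: (@unifPr_gt _ _ _ (fun w =>
    [exists a, delta ^ 2 < 3 * #|collisions O w.1 w.2 a|]%N) p) => // [w|].
    rewrite negb_exists => /forallP few; apply: few_collisions_recovery errE _ => // a.
    by rewrite leqNgt.
  apply: (failure_bound p9 p_le); first by rewrite card_prod muln_gt0 draw_gt0.
  by have := few_collisions_pair T0 delta12 col row small1T small2T; rewrite !card_ord.
apply: (@unifPr_gt _ _ _ (fun w =>
  [exists a, delta ^ 2 < 3 * #|collisions O w w a|]%N) p) => // [w|].
  rewrite negb_exists => /forallP few; apply: few_collisions_recovery errE _ => // a.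
  by rewrite leqNgt.
apply: (failure_bound p9 p_le draw_gt0).
apply: leq_trans (few_collisions T0 delta12 col row small1T small2T) _.
(* A single draw has only p left vertices; enlarging p to p + p lets [failure_bound] serve both
   cases. *)
by rewrite card_ord 3?leq_mul // leq_sqr leq_addr.
Qed.
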